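(* Let $(A,C)$, with $A\in\mathbb{R}^{n\times n}$ and $C\in\mathbb{R}^{1\times n}$, be an observable single-output system whose system matrix $A$ has distinct real eigenvalues $\lambda_1,\dots,\lambda_n$. Then the tensor systems $(A_{[p]},C^{[p]})$ are observable for all orders $p\in\mathbb{N}$, $p\ge 1$, if and only if the differences $$\lambda_2-\lambda_1,\ \dots,\ \lambda_n-\lambda_1$$ are linearly independent over $\mathbb{Q}$.
   Context: $(A,C)$ denotes the linear system $\dot x(t)=Ax(t)$, $y(t)=Cx(t)$. A linear system $(F,H)$ is observable if $\bigcap_{t\ge 0}\ker He^{Ft}=\{0\}$. For $x\in\mathbb{R}^k$ and an integer $p\ge 1$, $x^{[p]}\in\mathbb{R}^{N(k,p)}$, with $N(k,p)=\binom{k+p-1}{p}$, denotes the vector of weighted monomials $w_p(\alpha)\,x^{\alpha}$, where $\alpha=(\alpha_1,\dots,\alpha_k)$ runs through all multi-indices of non-negative integers with $\alpha_1+\dots+\alpha_k=p$, listed in decreasing lexicographic order, $x^\alpha = x_1^{\alpha_1}\cdots x_k^{\alpha_k}$, and $w_p(\alpha)=\sqrt{p!/(\alpha_1!\cdots\alpha_k!)}$. For $C\in\mathbb{R}^{m\times n}$, $C^{[p]}$ is the unique $N(m,p)\times N(n,p)$ matrix with $(Cx)^{[p]} = C^{[p]}x^{[p]}$ for all $x\in\mathbb{R}^n$. For $A\in\mathbb{R}^{n\times n}$, $A_{[p]}$ is the unique $N(n,p)\times N(n,p)$ matrix such that every solution of $\dot x(t)=Ax(t)$ satisfies $\frac{d}{dt}x^{[p]}(t)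 = A_{[p]}x^{[p]}(t)$. The $p$th order tensor system $(A_{[p]},C^{[p]})$ is $\dot x^{[p]}(t)=A_{[p]}x^{[p]}(t)$, $y^{[p]}(t)=C^{[p]}x^{[p]}(t)$, viewed as a linear system with state space $\mathbb{R}^{N(n,p)}$. *)

(* Defs.v *)
From HB Require Import structures.
From mathcomp Require Import all_boot all_order all_algebra.
From mathcomp Require Import all_classical all_reals all_analysis.

Set Implicit Arguments.
Unset Strict Implicit.
Unset Printing Implicit Defensive.

Import Order.TTheory GRing.Theory Num.Theory.
Import numFieldNormedType.Exports.

Local Open Scope classical_set_scope.
Local Open Scope ring_scope.

Definition expmx (R : realType) (n : nat) (F : 'M[R]_n) : 'M[R]_n :=
  limn (series (fun k : nat => (k`!%:R)^-1 *: F ^+ k)).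

Definition observable (R : realType) (m n : nat)
    (F : 'M[R]_n) (H : 'M[R]_(m, n)) : Prop :=
  \bigcap_(t in [set t : R | 0 <= t])
    [set x : 'cV[R]_n | (H *m expmx (t *: F)) *m x = 0] = [set 0].

Definition dimN (k p : nat) : nat := 'C((k + p).-1, p).

(* An exponent of a multi-index of total degree p is at most p, hence 'I_p.+1.
   The sort is for the decreasing lexicographic order. *)
Definition multi_indices (k p : nat) : seq (k.-tuplelexi 'I_p.+1) :=
  sort >=%O (enum [set a : k.-tuplelexi 'I_p.+1
                     | (\sum_(j < k) tnth a j)%N == p]%SET).

Lemma size_multi_indices (k p : nat) : size (multi_indices k p) = dimN k p.
Proof.
rewrite /multi_indices size_sort -cardE /dimN.
case: k => [|k].
  case: p => [|p].
    rewrite (_ : finset _ = [set: 0.-tuple 'I_1]%SET).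
      by rewrite cardsT card_tuple card_ord.
    by apply/setP => a; rewrite !inE big_ord0.
  rewrite add0n /= bin_small //; apply/eqP; rewrite cards_eq0; apply/eqP.
  by apply/setP => a; rewrite !inE big_ord0.
rewrite addSn /= -(@bin_sub (k + p) p) ?leq_addl // addnK.
rewrite -card_ord_partitions; apply: eq_card => a.
by rewrite !inE big_tuple.
Qed.

Definition multi_index (k p : nat) (i : 'I_(dimN k p)) : k.-tuplelexi 'I_p.+1 :=
  tnth (tcast (size_multi_indices k p) (in_tuple (multi_indices k p))) i.

Definition weight (R : realType) (k p : nat) (a : k.-tuplelexi 'I_p.+1) : R :=
  Num.sqrt (p`!%:R / \prod_(j < k) (tnth a j)`!%:R).

Definition tensor_vec (R : realType) (k p : nat) (x : 'cV[R]_k) :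
    'cV[R]_(dimN k p) :=
  \col_i (weight R (multi_index i)
          * \prod_(j < k) x j 0 ^+ tnth (multi_index i) j).

(* For nonempty P, get P is an element of P, so it is the unique element when
   P is a singleton, as is the case in the two definitions below. *)
Definition tensor_out (R : realType) (m n : nat) (C : 'M[R]_(m, n)) (p : nat) :
    'M[R]_(dimN m p, dimN n p) :=
  get [set M : 'M[R]_(dimN m p, dimN n p) |
    forall x : 'cV[R]_n, tensor_vec p (C *m x) = M *m tensor_vec p x].

Definition is_solution (R : realType) (n : nat) (A : 'M[R]_n)
    (x : R -> 'cV[R]_n) : Prop :=
  forall t : R, is_derive t 1 x (A *m x t).

Definition tensor_sys (R : realType) (n : nat) (A : 'M[R]_n) (p : nat) :
    'M[R]_(dimN n p) :=
  get [set M : 'M[R]_(dimN n p) |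
    forall x : R -> 'cV[R]_n, is_solution A x ->
      is_solution M (fun t => tensor_vec p (x t))].

Definition lin_indep_rat (R : realType) (n : nat) (v : 'I_n -> R) : Prop :=
  forall q : 'I_n -> rat,
    \sum_(i < n) ratr (q i) * v i = 0 -> forall i, q i = 0.

(* Main.v *)
Require Import Defs.
From mathcomp Require Import all_boot all_order all_algebra.
From mathcomp Require Import all_classical all_reals all_analysis.

Set Implicit Arguments.
Unset Strict Implicit.

Import Order.TTheory GRing.Theory Num.Theory.
Import numFieldNormedType.Exports.

Local Open Scope ring_scope.

(** Put [A] in diagonal form [A = P^-1 D P] and let [c = C P^-1]. In the
coordinates [z = P x] the output is [\sum_i c_i e^(lambda_i t) z_i], and real
exponentials with distinct rates are linearly independent, already when sampled
at [t = 0, 1, 2, ...]. So a diagonalised system with one output is observable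
if and only if its eigenvalues are distinct and every mode has a nonzero output
coefficient ([observable_conj_diag]).

The same criterion applies to the tensor systems, because the operation
[T |-> T^[p]] is multiplicative and hence diagonalises them as well:
[A_[p] = Q^-1 Delta Q] with [Q = P^[p]], where the diagonal matrix [Delta] has
the entries [alpha . lambda], [alpha] a multi-index of degree [p]
([tensor_sys_diag]). The output coefficients are the entries of
[C^[p] Q^-1 = c^[p]]. The entry at [alpha] is [c^alpha] times a positive
constant, so it is nonzero as soon as all [c_i] are
([tensor_out_row_neq0]); and they are, because [(A, C)] is observable.
Observability of all tensor systems therefore says that, for every [p >= 1], the
numbers [alpha . lambda] with [alpha] of degree [p] are distinct.

A coincidence [alpha . lambda = beta . lambda] between multi-indices of the same
degree is an integer relation among the [lambda_j] with coefficient sum zero,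
that is, an integer relation among the [lambda_j - lambda_0]. Conversely, such
a relation [m] comes from the multi-indices [m + K] and [K], with [K] a large
constant ([tensor_spec_inj]). Over a common denominator, rational relations are
the same as integer ones.

Both [C^[p]] and [A_[p]] are specified by their effect on the vectors [x^[p]],
so everything about them rests on the fact that these vectors span the whole
space ([tensor_vec_sep]). *)

(** * Power sums, diagonalisation and the matrix exponential *)

(** The functions [k |-> y_i ^ k] are independent when the [y_i] are distinct:
the hypothesis extends from powers to all polynomials, and a polynomial can
vanish at every [y_j] except one. This is the only independence argument used
below; exponentials and monomials are reduced to it. *)
Lemma power_sums_free (F : fieldType) (I : finType) (y c : I -> F) :
  injective y -> (forall k : nat, \sum_i c i * y i ^+ k = 0) ->
  forall i, c i = 0.
Proof.
move=> yI sum0 i0.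
have poly0 (q : {poly F}) : \sum_i c i * q.[y i] = 0.
  under eq_bigr => i _ do rewrite horner_coef mulr_sumr.
  rewrite exchange_big big1 //= => k _.
  under eq_bigr => i _ do rewrite mulrCA.
  by rewrite -mulr_sumr sum0 mulr0.
pose q : {poly F} := \prod_(j | j != i0) ('X - (y j)%:P).
have q_i0 : q.[y i0] != 0.
  rewrite horner_prod; apply/prodf_neq0 => j j_neq.
  by rewrite hornerXsubC subr_eq0 (inj_eq yI) eq_sym.
have := poly0 q; rewrite (bigD1 i0) //= big1 ?addr0 => [/eqP|i i_neq].
  by rewrite mulf_eq0 (negPf q_i0) orbF => /eqP.
by rewrite horner_prod (bigD1 i) //= hornerXsubC subrr mul0r mulr0.
Qed.

Lemma distinct_eigenvalues_diag (F : fieldType) (n : nat) (A : 'M[F]_n)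
    (lambda : 'I_n -> F) :
  injective lambda -> (forall i, eigenvalue A (lambda i)) ->
  exists2 P : 'M[F]_n, P \in unitmx &
    A = invmx P *m diag_mx (\row_i lambda i) *m P.
Proof.
move=> lambdaI eigA.
have /fin_all_exists [v vP] (i : 'I_n) :
    exists v : 'rV[F]_n, v *m A = lambda i *: v /\ v != 0.
  by have /eigenvalueP [v vA v0] := eigA i; exists v.
pose P : 'M[F]_n := \matrix_i v i.
set D := diag_mx _.
have PA : P *m A = D *m P.
  apply/row_matrixP => i; rewrite row_mul rowK (vP i).1.
  by rewrite mul_diag_mx; apply/rowP => j; rewrite !mxE.
have Punit : P \in unitmx.
  rewrite -row_free_unit -kermx_eq0; apply/eqP/row_matrixP => i0.
  rewrite row0; set u := row i0 _.
  have uP : u *m P = 0 by rewrite /u -row_mul mulmx_ker row0.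
  (* The relation [u] among the eigenvectors survives each application of [A]. *)
  have uk (k : nat) : \row_i (u 0 i * lambda i ^+ k) *m P = 0.
    elim: k => [|k IHk].
      rewrite -[RHS]uP; congr (_ *m _).
      by apply/rowP => i; rewrite !mxE expr0 mulr1.
    rewrite -[RHS](mul0mx _ A) -IHk -mulmxA PA mulmxA mul_mx_diag.
    by congr (_ *m _); apply/rowP => i; rewrite !mxE exprSr mulrA.
  apply/rowP => i; rewrite [RHS]mxE.
  have /rV0Pn [j vij] := (vP i).2.
  suff /eqP : u 0 i * v i 0 j = 0.
    by rewrite mulf_eq0 (negPf vij) orbF => /eqP.
  apply: (power_sums_free (c := fun l => u 0 l * v l 0 j) lambdaI) => k.
  have /rowP/(_ j) := uk k; rewrite !mxE => sum0; rewrite -[RHS]sum0.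
  by apply: eq_bigr => l _; rewrite !mxE mulrAC.
by exists P => //; rewrite -mulmxA -PA mulKmx.
Qed.

(** In this form a diagonalised matrix depends on its spectrum through finitely
many scalar factors, so that convergence of its exponential series is
convergence of scalar series. *)
Lemma conj_diag_sum (R : realType) (n : nat) (P : 'M[R]_n)
    (d : 'rV[R]_n) :
  invmx P *m diag_mx d *m P =
  \sum_i d 0 i *: (col i (invmx P) *m row i P).
Proof.
apply/matrixP => i j; rewrite mul_mx_diag summxE mxE.
apply: eq_bigr => k _; rewrite !mxE big_ord1 !mxE mulrAC.
by rewrite [LHS]mulrC.
Qed.

Lemma conj_diagX (R : realType) (n : nat) (P : 'M[R]_n)
    (d : 'rV[R]_n) (k : nat) :
  P \in unitmx ->
  (invmx P *m diag_mx d *m P) ^+ k =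
  invmx P *m diag_mx (\row_i d 0 i ^+ k) *m P.
Proof.
move=> Punit; elim: k => [|k IHk].
  rewrite expr0 (_ : diag_mx _ = 1%:M) ?mulmx1 ?mulVmx //.
  by apply/matrixP => i j; rewrite !mxE expr0.
rewrite exprSr IHk -mulmxE !mulmxA mulmxK // -(mulmxA (invmx P)).
congr (_ *m _ *m _); apply/matrixP => i j; rewrite mul_diag_mx !mxE exprSr.
by case: (eqVneq i j) => [->|_]; rewrite ?mulr1n // !mulr0n mulr0.
Qed.

Lemma expmx_diag (R : realType) (n : nat) (P : 'M[R]_n)
    (d : 'rV[R]_n) :
  P \in unitmx ->
  expmx (invmx P *m diag_mx d *m P) =
  invmx P *m diag_mx (map_mx expR d) *m P.
Proof.
move=> Punit; rewrite /expmx.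
pose E i := col i (invmx P) *m row i P.
rewrite (_ : series _ =
    fun N => \sum_i series (exp_coeff (d 0 i)) N *: E i); last first.
  apply/funext => N; rewrite /series /=.
  under eq_bigr => k _ do
    rewrite conj_diagX // conj_diag_sum scaler_sumr.
  rewrite exchange_big /=; apply: eq_bigr => i _.
  rewrite scaler_suml; apply: eq_bigr => k _.
  by rewrite scalerA mxE /exp_coeff /= mulrC.
apply/cvg_lim => //; rewrite conj_diag_sum.
have cvgi (i : 'I_n) : (series (exp_coeff (d 0 i)) N *: E i @[N --> \oo]
    --> map_mx expR d 0 i *: E i)%classic.
  by apply: cvgZr_tmp; rewrite mxE; exact: is_cvg_series_exp_coeff.
by apply: cvg_big => //; exact: add_continuous.
Qed.

(** * Observability of a diagonalised system with one output *)

Lemma observableP (R : realType) (m n : nat) (F : 'M[R]_n) (H : 'M[R]_(m, n)) :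
  observable F H <->
  forall x : 'cV[R]_n,
    (forall t, 0 <= t -> H *m expmx (t *: F) *m x = 0) -> x = 0.
Proof.
rewrite /observable; split=> [Hobs x x0|Hobs].
  have : (\bigcap_(t in [set t | 0 <= t])
    [set x | (H *m expmx (t *: F)) *m x = 0])%classic x by move=> t /= /x0.
  by rewrite Hobs.
apply/seteqP; split=> [x x0|x -> t _ /=]; last by rewrite mulmx0.
exact: Hobs.
Qed.

(** Mode [i] reaches the output as [h_i e^(d_i t)], with [h = H P^-1]. If [h_i]
vanishes then mode [i] is invisible; if [d_j = d_k] then modes [j] and [k] can be
combined to cancel. In the remaining case the outputs at integer times are
power sums of the distinct numbers [e^(d_i)]. The number of outputs is a
variable equal to [1] because that of a tensor system is [dimN 1 p]. *)
Lemma observable_conj_diag (R : realType) (m n : nat) (P : 'M[R]_n)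
    (d : 'rV[R]_n) (H : 'M[R]_(m, n)) :
  m = 1%N -> P \in unitmx ->
  observable (invmx P *m diag_mx d *m P) H <->
  injective (d 0) /\ forall i j, (H *m invmx P) i j != 0.
Proof.
move=> m1 Punit; subst m.
set h := H *m invmx P.
have output (t : R) (x : 'cV[R]_n) :
    H *m expmx (t *: (invmx P *m diag_mx d *m P)) *m x =
    (\sum_i h 0 i * (P *m x) i 0 * expR (t * d 0 i))%:M.
  rewrite scalemxAl scalemxAr -linearZ /= expmx_diag //.
  rewrite !mulmxA -/h -mulmxA [LHS]mx11_scalar mxE.
  congr (_%:M); apply: eq_bigr => i _.
  by rewrite mul_mx_diag !mxE mulrAC.
clearbody h; rewrite observableP; split=> [obs|[dI h0] x x0].
- have modes0 (z : 'cV[R]_n) :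
      (forall t, \sum_i h 0 i * z i 0 * expR (t * d 0 i) = 0) -> z = 0.
    move=> z0; rewrite -(mulKVmx Punit z) (obs (invmx P *m z)) ?mulmx0 //.
    by move=> t _; rewrite output mulKVmx // z0 raddf0.
  have h0 j : h 0 j != 0.
    apply/eqP => hj0.
    have /colP/(_ j) : delta_mx j 0 = 0 :> 'cV[R]_n.
      apply: modes0 => t; rewrite big1 // => i _; rewrite mxE.
      by case: (eqVneq i j) => [->|_] /=; rewrite ?hj0 ?mulr0n ?mulr0 !mul0r.
    by rewrite !mxE !eqxx => /eqP; rewrite oner_eq0.
  split=> [j k djk|i j]; last by rewrite ord1.
  apply/eqP/contraT => jk.
  have /colP/(_ j) : h 0 k *: delta_mx j 0 - h 0 j *: delta_mx k 0
      = 0 :> 'cV[R]_n.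
    apply: modes0 => t; rewrite (bigD1 j) // (bigD1 k) 1?eq_sym //= big1.
      rewrite !mxE !eqxx (negPf jk) eq_sym (negPf jk) -djk /=.
      rewrite !mulr1 !mulr0 subr0 sub0r addr0 mulrN mulNr.
      by rewrite [h 0 k * _]mulrC subrr.
    move=> i /andP[/negPf ij /negPf ik]; rewrite !mxE ij ik /=.
    by rewrite !mulr0 subrr mulr0 mul0r.
  rewrite !mxE !eqxx (negPf jk) /= mulr1 mulr0 subr0 => /eqP.
  by rewrite (negPf (h0 k)).
- have eI : injective (fun i => expR (d 0 i)).
    by move=> i j /expR_inj /dI.
  rewrite -(mulKmx Punit x) (_ : P *m x = 0) ?mulmx0 //.
  apply/colP => i; rewrite [RHS]mxE.
  suff /eqP : h 0 i * (P *m x) i 0 = 0.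
    by rewrite mulf_eq0 (negPf (h0 _ _)) => /eqP.
  apply: (power_sums_free (c := fun l => h 0 l * (P *m x) l 0) eI) => k.
  have := x0 k%:R (ler0n _ _); rewrite output => /matrixP/(_ 0 0).
  rewrite !mxE mulr1n => sum0; rewrite -[RHS]sum0; apply: eq_bigr => l _.
  by rewrite -expRM_natl.
Qed.

(** * Multi-indices as contents of words *)

Lemma digits_inj (B k : nat) (a b : 'I_k -> nat) :
  (forall j, (a j < B)%N) -> (forall j, (b j < B)%N) ->
  (\sum_j a j * B ^ j = \sum_j b j * B ^ j)%N -> forall j, a j = b j.
Proof.
elim: k a b => [|k IHk] a b aB bB; first by move=> _ [].
have shift (c : 'I_k.+1 -> nat) :
    (\sum_j c j * B ^ j = (\sum_j c (lift ord0 j) * B ^ j) * B + c ord0)%N.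
  rewrite big_ord_recl expn0 muln1 addnC big_distrl /=; congr (_ + _)%N.
  by apply: eq_bigr => j _; rewrite -mulnA -expnSr.
have B_gt0 : (0 < B)%N by exact: leq_trans (aB ord0).
rewrite !shift => eqs.
have e0 : a ord0 = b ord0.
  by have := congr1 (modn^~ B) eqs; rewrite !modnMDl !modn_small.
move: eqs; rewrite e0 => /addIn/eqP; rewrite eqn_pmul2r // => /eqP eqs j.
have [i ->|->//] := unliftP ord0 j.
exact: (IHk (fun i => a (lift ord0 i)) (fun i => b (lift ord0 i))).
Qed.

Lemma multi_index_inj (k p : nat) : injective (@multi_index k p).
Proof.
apply/tuple_uniqP; rewrite val_tcast /= sort_uniq; exact: enum_uniq.
Qed.

Lemma mem_multi_index (k p : nat) (a : k.-tuplelexi 'I_p.+1) :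
  (exists i, multi_index i = a) <-> (\sum_(j < k) tnth a j = p)%N.
Proof.
have memE : (a \in multi_indices k p) = (\sum_(j < k) tnth a j == p)%N.
  by rewrite mem_sort mem_enum inE.
split=> [[i ia]|/eqP]; last rewrite -memE => ain.
  apply/eqP; rewrite -memE -ia /multi_index.
  set t := tcast _ _.
  by have := mem_tnth i t; rewrite memtE val_tcast.
have /tnthP [i ->] :
    a \in tcast (size_multi_indices k p) (in_tuple (multi_indices k p)).
  by rewrite memtE val_tcast.
by exists i.
Qed.

Lemma sum_multi_index (k p : nat) (i : 'I_(dimN k p)) :
  (\sum_(j < k) tnth (multi_index i) j = p)%N.
Proof. by apply/mem_multi_index; exists i. Qed.

Lemma multi_index_exists (k p : nat) (a : 'I_k -> nat) :
  (\sum_j a j = p)%N ->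
  exists i : 'I_(dimN k p), forall j, tnth (multi_index i) j = a j :> nat.
Proof.
(* An entry of a sum equal to [p] is at most [p], so it fits into 'I_p.+1. *)
move=> ap; have aP j : (a j < p.+1)%N.
  by rewrite ltnS -ap (bigD1 j) //= leq_addr.
have /mem_multi_index [i ia] :
    (\sum_(j < k)
       tnth ([tuple inord (a j) | j < k] : k.-tuplelexi 'I_p.+1) j = p)%N.
  by rewrite -[RHS]ap; apply: eq_bigr => j _; rewrite tnth_mktuple inordK.
by exists i => j; rewrite ia tnth_mktuple inordK.
Qed.

(** A word [f] of length [p] in [k] letters stands for the noncommutative monomial
[x_(f 0) ... x_(f (p - 1))]; its content is the exponent of that monomial once
the variables commute. Working with words replaces the multinomial theorem by
the plain distributivity of products over sums. *)
Definition content (k p : nat) (f : {ffun 'I_p -> 'I_k}) (j : 'I_k) : nat :=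
  #|[pred l | f l == j]|.

Lemma sum_content (k p : nat) (f : {ffun 'I_p -> 'I_k}) :
  (\sum_j content f j = p)%N.
Proof.
rewrite -[RHS]card_ord -sum1_card (partition_big f predT) //=.
apply: eq_bigr => j _; rewrite /content -sum1_card.
by apply: eq_bigl => l; rewrite inE.
Qed.

Lemma prod_content (R : comPzRingType) (k p : nat) (f : {ffun 'I_p -> 'I_k})
    (x : 'I_k -> R) :
  \prod_l x (f l) = \prod_j x j ^+ content f j.
Proof.
rewrite (partition_big f predT) //=; apply: eq_bigr => j _.
rewrite -prodr_const; apply: eq_big => // l.
by move=> /eqP->.
Qed.

Lemma content_exists (k p : nat) (a : 'I_k -> nat) :
  (\sum_j a j = p)%N ->
  exists f : {ffun 'I_p -> 'I_k}, forall j, content f j = a j.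
Proof.
(* The word that lists each letter [j] exactly [a j] times. *)
move=> ap; pose s := flatten [seq nseq (a j) j | j <- enum 'I_k].
have size_s : size s == p.
  rewrite size_flatten /shape -map_comp sumnE big_map big_enum /=.
  rewrite -[X in _ == X]ap.
  by apply/eqP/eq_bigr => j _; rewrite size_nseq.
have content_tnth (t : p.-tuple 'I_k) j :
    content [ffun l => tnth t l] j = count_mem j t.
  rewrite -[in RHS](map_tnth_enum t) count_map.
  rewrite /content cardE enumT -size_filter; congr size.
  by apply: eq_filter => l; rewrite !inE ffunE.
exists [ffun l => tnth (Tuple size_s) l] => j; rewrite content_tnth /=.
rewrite count_flatten -map_comp sumnE big_map big_enum /= (bigD1 j) //=.
rewrite count_nseq /= eqxx mul1n big1 ?addn0 // => i ij.
by rewrite count_nseq /= (negPf ij).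
Qed.

Lemma content_index_exists (k p : nat) (f : {ffun 'I_p -> 'I_k}) :
  exists i : 'I_(dimN k p),
    forall j, tnth (multi_index i) j = content f j :> nat.
Proof. exact/multi_index_exists/sum_content. Qed.

Definition content_index (k p : nat) (f : {ffun 'I_p -> 'I_k}) : 'I_(dimN k p) :=
  sval (cid (content_index_exists f)).

Lemma content_indexE (k p : nat) (f : {ffun 'I_p -> 'I_k}) j :
  tnth (multi_index (content_index f)) j = content f j :> nat.
Proof. by rewrite /content_index; case: cid. Qed.

Lemma content_index_surj (k p : nat) (i : 'I_(dimN k p)) :
  exists f : {ffun 'I_p -> 'I_k}, content_index f = i.
Proof.
have [f fi] := content_exists (sum_multi_index i); exists f.
apply/multi_index_inj/eq_from_tnth => j; apply: val_inj.
by rewrite /= content_indexE fi.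
Qed.

(** * Tensor powers of vectors and matrices *)

Lemma weight_neq0 (R : realType) (k p : nat) (a : k.-tuplelexi 'I_p.+1) :
  weight R a != 0.
Proof.
rewrite /weight sqrtr_eq0 -ltNge divr_gt0 ?ltr0n ?fact_gt0 //.
by apply: prodr_gt0 => j _; rewrite ltr0n fact_gt0.
Qed.

Lemma tensor_vec_content (R : realType) (k p : nat) (x : 'cV[R]_k)
    (f : {ffun 'I_p -> 'I_k}) :
  tensor_vec p x (content_index f) 0 =
  weight R (multi_index (content_index f)) * \prod_l x (f l) 0.
Proof.
rewrite mxE (prod_content f (x ^~ 0)); congr (_ * _).
by apply: eq_bigr => j _; rewrite content_indexE.
Qed.

(** Coordinate at [i] of the product of the [p] linear forms [b l], expressed in
the weighted monomials of [tensor_vec]: each word with that content contributes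
the product of the coefficients it picks. *)
Definition form_coeff (R : realType) (k p : nat) (b : 'I_p -> 'I_k -> R)
    (i : 'I_(dimN k p)) : R :=
  (\sum_(f | content_index f == i) \prod_l b l (f l)) / weight R (multi_index i).

Lemma prod_linear_forms (R : realType) (k p : nat) (b : 'I_p -> 'I_k -> R)
    (x : 'cV[R]_k) :
  \prod_l \sum_j b l j * x j 0 =
  \sum_i form_coeff b i * tensor_vec p x i 0.
Proof.
rewrite bigA_distr_bigA (partition_big (@content_index k p) predT) //=.
apply: eq_bigr => i _; rewrite /form_coeff mulrAC mulr_suml.
rewrite mulr_suml; apply: eq_bigr => f /eqP <-.
rewrite tensor_vec_content mulrCA [RHS]mulrAC divff ?weight_neq0 // mul1r.
by rewrite big_split.
Qed.

(** The vectors [x^[p]] span: no nonzero functional vanishes on all of them. On the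
points [x_j = (2 ^ (p + 1) ^ j) ^ n], [n = 0, 1, 2, ...], a monomial of degree [p]
takes the value [y ^ n], where [y] is [2] raised to the number whose base [p + 1]
digits are the exponents of the monomial. Distinct monomials thus give distinct
[y], and the vanishing of all power sums forces every coefficient to be zero. *)
Lemma tensor_vec_sep (R : realType) (k p : nat) (u : 'I_(dimN k p) -> R) :
  (forall x, \sum_i u i * tensor_vec p x i 0 = 0) -> forall i, u i = 0.
Proof.
move=> u0 i.
pose e (i : 'I_(dimN k p)) :=
  (\sum_(j < k) tnth (multi_index i) j * p.+1 ^ j)%N.
have eI : injective (fun i => 2%:R ^+ e i : R).
  move=> i1 i2 /eqP; rewrite -!natrX eqr_nat eqn_exp2l //.
  move=> /eqP/digits_inj eq12.
  apply/multi_index_inj/eq_from_tnth => j; apply: val_inj.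
  by apply: eq12 => l; exact: ltn_ord.
suff /eqP : u i * weight R (multi_index i) = 0.
  by rewrite mulf_eq0 (negPf (weight_neq0 _ _)) orbF => /eqP.
apply: (power_sums_free (c := fun i => u i * weight R (multi_index i)) eI) => n.
rewrite -[RHS](u0 (\col_j (2%:R ^+ (p.+1 ^ j)) ^+ n)).
apply: eq_bigr => l _; rewrite mxE mulrA; congr (_ * _).
rewrite exprAC /e -prodrXr; apply: eq_bigr => j _.
by rewrite mxE -!exprM mulnA [in LHS]mulnC.
Qed.

Lemma tensor_vec_ext (R : realType) (k m p : nat) (M N : 'M[R]_(m, dimN k p)) :
  (forall x, M *m tensor_vec p x = N *m tensor_vec p x) -> M = N.
Proof.
move=> MN; apply/matrixP => i j; apply/eqP; rewrite -subr_eq0; apply/eqP.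
apply: (tensor_vec_sep (u := fun j => M i j - N i j)) => x.
under eq_bigr do rewrite mulrBl.
by rewrite sumrB; have /colP/(_ i) := MN x; rewrite !mxE => ->; rewrite subrr.
Qed.

(** Up to its weight, a coordinate of [(T x)^[p]] is a product of [p] linear forms
in [x], one for each letter of a word [f] with the right content. *)
Lemma tensor_vec_mul (R : realType) (m k p : nat) (T : 'M[R]_(m, k))
    (f : {ffun 'I_p -> 'I_m}) (x : 'cV[R]_k) :
  tensor_vec p (T *m x) (content_index f) 0 =
  \sum_j weight R (multi_index (content_index f))
          * form_coeff (fun l => T (f l)) j * tensor_vec p x j 0.
Proof.
rewrite tensor_vec_content; under eq_bigr do rewrite mxE.
rewrite prod_linear_forms mulr_sumr.
by apply: eq_bigr => j _; rewrite mulrA.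
Qed.

Lemma tensor_outP (R : realType) (m k : nat) (T : 'M[R]_(m, k)) (p : nat) x :
  tensor_vec p (T *m x) = tensor_out T p *m tensor_vec p x.
Proof.
pose S := [set M : 'M[R]_(dimN m p, dimN k p) |
  forall x, tensor_vec p (T *m x) = M *m tensor_vec p x]%classic.
move: x; suff : S (tensor_out T p) by [].
apply: getPex.
have /fin_all_exists [f fP] := @content_index_surj m p.
exists (\matrix_(i, j) (weight R (multi_index i)
                        * form_coeff (fun l => T (f i l)) j)) => x /=.
apply/colP => i; rewrite -{1}[i]fP tensor_vec_mul [RHS]mxE fP.
by apply: eq_bigr => j _; congr (_ * _); rewrite mxE.
Qed.

Lemma tensor_outE (R : realType) (m k p : nat) (T : 'M[R]_(m, k))
    (f : {ffun 'I_p -> 'I_m}) j :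
  tensor_out T p (content_index f) j =
  weight R (multi_index (content_index f)) * form_coeff (fun l => T (f l)) j.
Proof.
apply/eqP; rewrite -subr_eq0; apply/eqP; set i := content_index f.
apply: (tensor_vec_sep (u := fun j => tensor_out T p i j
  - weight R (multi_index i) * form_coeff (fun l => T (f l)) j)) => x.
under eq_bigr do rewrite mulrBl.
by rewrite sumrB -tensor_vec_mul tensor_outP [X in _ - X]mxE subrr.
Qed.

Lemma tensor_outM (R : realType) (m k n p : nat) (T : 'M[R]_(m, k))
    (U : 'M[R]_(k, n)) :
  tensor_out (T *m U) p = tensor_out T p *m tensor_out U p.
Proof. by apply: tensor_vec_ext => x; rewrite -mulmxA -!tensor_outP mulmxA. Qed.

Lemma tensor_out1 (R : realType) (k p : nat) :
  tensor_out (1%:M : 'M[R]_k) p = 1%:M.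
Proof. by apply: tensor_vec_ext => x; rewrite -tensor_outP !mul1mx. Qed.

Lemma tensor_outV (R : realType) (k p : nat) (P : 'M[R]_k) :
  P \in unitmx ->
  tensor_out P p \in unitmx /\ tensor_out (invmx P) p = invmx (tensor_out P p).
Proof.
move=> Punit; have QV : tensor_out P p *m tensor_out (invmx P) p = 1%:M.
  by rewrite -tensor_outM mulmxV // tensor_out1.
have [Qunit _] := mulmx1_unit QV; split=> //.
by rewrite -[LHS](mulKmx Qunit) QV mulmx1.
Qed.

(** All words with content [alpha] contribute the same product [c^alpha], and there
is at least one such word; so the entry is nonzero in characteristic zero. *)
Lemma tensor_out_row_neq0 (R : realType) (k p : nat) (c : 'M[R]_(1, k)) :
  (forall j, c 0 j != 0) -> forall i j, tensor_out c p i j != 0.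
Proof.
move=> c0 i j; have [f <-] := content_index_surj i.
rewrite tensor_outE mulf_neq0 ?weight_neq0 //.
rewrite mulf_neq0 ?invr_eq0 ?weight_neq0 //.
rewrite (eq_bigr (fun=> \prod_(l < k) c 0 l ^+ tnth (multi_index j) l));
    last first.
  move=> g /eqP <-; under eq_bigr => l _ do rewrite ord1.
  rewrite (prod_content g (c 0)).
  by apply: eq_bigr => l _; rewrite content_indexE.
rewrite sumr_const -mulr_natr mulf_neq0 //.
  by apply/prodf_neq0 => l _; rewrite expf_neq0.
have [g gj] := content_index_surj j.
rewrite pnatr_eq0 -lt0n; apply/card_gt0P; exists g; exact: (introT eqP gj).
Qed.

(** * Solutions of linear systems and the tensor system matrix *)

Lemma is_derive_mxP (R : realFieldType) (V : normedModType R) (m n : nat)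
    (M : V -> 'M[R]_(m, n)) (t v : V) (dM : 'M[R]_(m, n)) :
  is_derive t v M dM <->
  forall i j, is_derive t v (fun s => M s i j) (dM i j).
Proof.
split=> [[dMt <-] i j|dMij].
  have /derivable_mxP dMij := dMt.
  by apply: DeriveDef => //; rewrite derive_mx // mxE.
have dMt : derivable M t v by apply/derivable_mxP => i j; case: (dMij i j).
apply: DeriveDef => //; rewrite derive_mx //.
by apply/matrixP => i j; rewrite mxE; case: (dMij i j).
Qed.

(** An intertwining [B] of [F] and [G] carries trajectories to trajectories.
The changes of coordinates by [P] and by [P^[p]] are both instances. *)
Lemma is_solution_mulmx (R : realType) (m n : nat) (F : 'M[R]_n) (G : 'M[R]_m)
    (B : 'M[R]_(m, n)) (x : R -> 'cV[R]_n) :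
  B *m F = G *m B -> is_solution F x -> is_solution G (fun t => B *m x t).
Proof.
move=> BF Fx t; apply/is_derive_mxP => i j; rewrite mulmxA -BF -mulmxA mxE.
have -> : (fun s => (B *m x s) i j) = \sum_k (B i k \*: fun s => x s k j).
  by apply/funext => s; rewrite mxE fct_sumE.
by apply: is_derive_sum => k; apply: is_deriveZ; have /is_derive_mxP := Fx t.
Qed.

Lemma is_derive_expRM (R : realType) (a t : R) :
  is_derive t 1 (fun s => expR (a * s)) (a * expR (a * t)).
Proof.
have da : is_derive t 1 (a \*: (id : R -> R)) (a *: 1) by exact: is_deriveZ.
have := is_derive1_comp (is_derive_expR (a * t)) da.
by rewrite /GRing.scale /= mulr1 mulrC.
Qed.

(** Leibniz rule for eigenfunctions of the derivation [d/dt]: the eigenvalues of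
the factors add up. This is why the spectrum of the tensor system consists of
sums of eigenvalues. *)
Lemma eigenmode_prod (R : realType) (I : Type) (r : seq I) (a : I -> R)
    (z : I -> R -> R) (t : R) :
  (forall j, is_derive t 1 (z j) (a j * z j t)) ->
  is_derive t 1 (fun s => \prod_(j <- r) z j s)
    ((\sum_(j <- r) a j) * \prod_(j <- r) z j t).
Proof.
move=> dz; elim: r => [|j r IHr].
  rewrite !big_nil mul0r.
  have -> : (fun s => \prod_(j <- [::]) z j s) = cst 1.
    by apply/funext => s; rewrite big_nil.
  exact: is_derive_cst.
have -> : (fun s => \prod_(i <- j :: r) z i s) =
    z j * (fun s => \prod_(i <- r) z i s).
  by apply/funext => s; rewrite big_cons.
rewrite !big_cons; apply: is_derive_eq.
rewrite /GRing.scale /= mulrDl addrC; congr (_ + _); last exact: mulrCA.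
by rewrite mulrC mulrA.
Qed.

Lemma is_solution_diag (R : realType) (n : nat) (d : 'rV[R]_n)
    (z : R -> 'cV[R]_n) :
  is_solution (diag_mx d) z <->
  forall i (t : R), is_derive t 1 (fun s => z s i 0) (d 0 i * z t i 0).
Proof.
split=> [Dz i t|Dz t].
  by have /is_derive_mxP/(_ i 0) := Dz t; rewrite mul_diag_mx mxE.
by apply/is_derive_mxP => i j; rewrite mul_diag_mx mxE ord1; exact: Dz.
Qed.

Lemma diag_solution_exists (R : realType) (n : nat) (P : 'M[R]_n)
    (d : 'rV[R]_n) (x0 : 'cV[R]_n) :
  P \in unitmx ->
  exists2 x, is_solution (invmx P *m diag_mx d *m P) x & x 0 = x0.
Proof.
move=> Punit.
pose z t : 'cV[R]_n := \col_i (expR (d 0 i * t) * (P *m x0) i 0).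
exists (fun t => invmx P *m z t).
  apply: (@is_solution_mulmx _ _ _ (diag_mx d)); first by rewrite mulmxK.
  apply/is_solution_diag => i t; rewrite mxE.
  have -> : (fun s => z s i 0) =
      (P *m x0) i 0 \*: (fun s => expR (d 0 i * s)).
    by apply/funext => s; rewrite mxE mulrC.
  rewrite mulrA mulrC; apply: is_deriveZ; exact: is_derive_expRM.
rewrite -[RHS](mulKmx Punit); congr (_ *m _).
by apply/colP => i; rewrite mxE mulr0 expR0 mul1r.
Qed.

Definition tensor_spec (R : realType) (n : nat) (d : 'rV[R]_n) (p : nat) :
    'rV[R]_(dimN n p) :=
  \row_i \sum_(j < n) d 0 j *+ tnth (multi_index i) j.

Lemma tensor_specE (R : realType) (n p : nat) (d : 'rV[R]_n)
    (f : {ffun 'I_p -> 'I_n}) :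
  tensor_spec d p 0 (content_index f) = \sum_l d 0 (f l).
Proof.
rewrite mxE [RHS](partition_big f predT) //=; apply: eq_bigr => j _.
rewrite content_indexE -sumr_const; apply: eq_big => // l.
by move=> /eqP->.
Qed.

Lemma tensor_vec_diag_solution (R : realType) (n p : nat) (d : 'rV[R]_n)
    (z : R -> 'cV[R]_n) :
  is_solution (diag_mx d) z ->
  is_solution (diag_mx (tensor_spec d p)) (fun t => tensor_vec p (z t)).
Proof.
move=> /is_solution_diag Dz; apply/is_solution_diag => i t.
have [f <-] := content_index_surj i.
have -> : (fun s => tensor_vec p (z s) (content_index f) 0) =
    weight R (multi_index (content_index f)) \*: (fun s => \prod_l z s (f l) 0).
  by apply/funext => s; rewrite tensor_vec_content.
rewrite tensor_vec_content mulrCA tensor_specE; apply: is_deriveZ.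
by apply: (@eigenmode_prod _ _ _ (fun l => d 0 (f l)) (fun l s => z s (f l) 0)).
Qed.

(** The specification of [A_[p]] only concerns trajectories. Through every [x0]
passes one, and comparing derivatives there shows that any matrix meeting the
specification agrees with [Q^-1 Delta Q] on [x0^[p]]; these vectors span. *)
Lemma tensor_sys_diag (R : realType) (n p : nat) (P : 'M[R]_n) (d : 'rV[R]_n) :
  P \in unitmx ->
  tensor_sys (invmx P *m diag_mx d *m P) p =
  invmx (tensor_out P p) *m diag_mx (tensor_spec d p) *m tensor_out P p.
Proof.
move=> Punit; set A := invmx P *m _ *m P.
have [Qunit _] := tensor_outV p Punit; set Q := tensor_out P p in Qunit *.
set B := invmx Q *m _ *m Q.
pose S := [set M : 'M[R]_(dimN n p) | forall x, is_solution A x ->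
  is_solution M (fun t => tensor_vec p (x t))]%classic.
have SB : S B.
  move=> x Ax.
  have -> : (fun t => tensor_vec p (x t)) =
      fun t => invmx Q *m tensor_vec p (P *m x t).
    by apply/funext => t; rewrite tensor_outP mulKmx.
  apply: (@is_solution_mulmx _ _ _ (diag_mx (tensor_spec d p))).
    by rewrite mulmxK.
  apply: tensor_vec_diag_solution; apply: is_solution_mulmx Ax.
  by rewrite !mulmxA mulmxV ?mul1mx.
have SM : S (tensor_sys A p) by apply: getPex; exists B.
apply: tensor_vec_ext => x0.
have [x Ax <-] := diag_solution_exists d x0 Punit.
by case: (SM x Ax 0) => _ <-; case: (SB x Ax 0) => _ <-.
Qed.

(** * Coincidences in the tensor spectra and rational relations *)

Lemma lin_indep_rat_int (R : realType) (n : nat) (v : 'I_n -> R) :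
  lin_indep_rat v <->
  forall m : 'I_n -> int, \sum_i (m i)%:~R * v i = 0 -> forall i, m i = 0.
Proof.
split=> [indep m m0 i|indep q q0 i].
  apply/eqP; rewrite -(intr_eq0 rat); apply/eqP.
  apply: (indep (fun i => (m i)%:~R)); rewrite -[RHS]m0.
  by apply: eq_bigr => j _; rewrite ratr_int.
pose D := \prod_j denq (q j).
have qD j : exists m : int, m%:~R = q j * D%:~R.
  exists (numq (q j) * \prod_(l | l != j) denq (q l)).
  rewrite /D [in RHS](bigD1 j) //= !intrM mulrA; congr (_ * _).
  by rewrite -[X in _ = X * _]divq_num_den divfK // intr_eq0 denq_neq0.
have [m mP] := fin_all_exists qD.
have D0 : D%:~R != 0 :> rat.
  by rewrite intr_eq0; apply/prodf_neq0 => j _; exact: denq_neq0.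
suff mi0 : m i = 0.
  by apply/eqP; have /eqP := mP i; rewrite mi0 eq_sym mulf_eq0 (negPf D0) orbF.
apply: indep; rewrite -[RHS](mul0r (ratr D%:~R)) -[in RHS]q0 mulr_suml.
by apply: eq_bigr => j _; rewrite mulrAC -rmorphM /= -mP ratr_int.
Qed.

(** A relation [\sum_i m_i (lambda_(i+1) - lambda_0) = 0] extends to a relation [M]
among the [lambda_j] themselves with coefficient sum zero. Adding a constant [K]
with [K > |M_j|] for all [j] makes its coefficients natural numbers, and [M + K]
and the constant [K] are two multi-indices of the same degree [(n + 1) K], with
the same eigenvalue. Conversely, two multi-indices with the same eigenvalue
differ by such a relation, since their common degree cancels [lambda_0]. *)
Lemma tensor_spec_inj (R : realType) (n : nat) (lambda : 'I_n.+1 -> R) :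
  (forall p, (1 <= p)%N -> injective (tensor_spec (\row_j lambda j) p 0)) <->
  lin_indep_rat (fun i : 'I_n => lambda (lift ord0 i) - lambda ord0).
Proof.
rewrite lin_indep_rat_int; split=> [specI m m0 i|indep p _ i1 i2 eq12].
- pose M j := if unlift ord0 j is Some i then m i else - \sum_i m i.
  have M_ord0 : M ord0 = - \sum_i m i by rewrite /M unlift_none.
  have M_lift j : M (lift ord0 j) = m j by rewrite /M liftK.
  have M_sum : \sum_j M j = 0.
    by rewrite big_ord_recl M_ord0 (eq_bigr _ (fun j _ => M_lift j)) addNr.
  have M_rel : \sum_j (M j)%:~R * lambda j = 0.
    rewrite big_ord_recl M_ord0 -[RHS]m0.
    under [X in _ + X]eq_bigr => j _ do rewrite M_lift.
    under [RHS]eq_bigr => j _ do rewrite mulrBr.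
    by rewrite sumrB addrC rmorphN rmorph_sum mulNr mulr_suml.
  (* The successor makes the degree [(n + 1) K] positive even if [M] is zero. *)
  pose K := (\sum_j `|M j|%N).+1%N.
  have MK j : (absz (M j + K%:Z))%:Z = M j + K%:Z.
    apply: gez0_abs; rewrite -lerBlDl sub0r; apply: le_trans (ler_norm _) _.
    by rewrite normrN -abszE /K (bigD1 j) //= lez_nat leqW // leq_addr.
  have [j1 j1E] : exists j1 : 'I_(dimN n.+1 (n.+1 * K)),
      forall j, tnth (multi_index j1) j = absz (M j + K%:Z) :> nat.
    apply: multi_index_exists; apply/eqP; rewrite -eqz_nat; apply/eqP.
    rewrite (big_morph Posz PoszD erefl) (eq_bigr _ (fun j _ => MK j)).
    by rewrite big_split /= M_sum add0r sumr_const card_ord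
      -mulr_natr natz mulnC.
  have [j2 j2E] : exists j2 : 'I_(dimN n.+1 (n.+1 * K)),
      forall j, tnth (multi_index j2) j = K :> nat.
    by apply: multi_index_exists; rewrite sum_nat_const card_ord.
  have j12 : j1 = j2.
    apply: (specI (n.+1 * K)%N) => //.
    rewrite !mxE -[RHS]addr0 -[X in _ = _ + X]M_rel -big_split /=.
    apply: eq_bigr => j _.
    rewrite j1E j2E mxE -[LHS]mulr_natr pmulrn MK intrD mulrDr addrC.
    by rewrite -pmulrn mulr_natr mulrC.
  have := MK (lift ord0 i); rewrite -j1E j12 j2E M_lift.
  by rewrite -[LHS]add0r => /addIr.
- pose a1 := tnth (multi_index i1); pose a2 := tnth (multi_index i2).
  have sum_lambda0 (a : 'I_n.+1 -> nat) : (\sum_j a j = p)%N ->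
      \sum_(i < n) (a (lift ord0 i))%:R * (lambda (lift ord0 i) - lambda ord0)
      = \sum_j lambda j *+ a j - lambda ord0 *+ p.
    move=> <-; rewrite -sumrMnr -sumrB [RHS]big_ord_recl subrr add0r.
    by apply: eq_bigr => j _; rewrite mulr_natl mulrnBl.
  have lift12 j : a1 (lift ord0 j) = a2 (lift ord0 j) :> nat.
    apply/eqP; rewrite -eqz_nat -subr_eq0; apply/eqP; move: j.
    apply: (indep (fun j => (a1 (lift ord0 j))%:Z - (a2 (lift ord0 j))%:Z)).
    under eq_bigr do rewrite intrB mulrBl -!pmulrn.
    rewrite sumrB (sum_lambda0 a1) ?(sum_lambda0 a2) ?sum_multi_index //.
    move: eq12; rewrite !mxE; under eq_bigr do rewrite mxE.
    by under [X in _ = X]eq_bigr do rewrite mxE; move=> ->; rewrite subrr.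
  apply/multi_index_inj/eq_from_tnth => j; apply: val_inj => /=.
  have [i ->|->] := unliftP ord0 j; first exact: lift12.
  have := etrans (sum_multi_index i1) (esym (sum_multi_index i2)).
  rewrite !big_ord_recl (eq_bigr _ (fun j _ => lift12 j)).
  exact: addIn.
Qed.

Theorem theorem16 (R : realType) (n : nat)
    (A : 'M[R]_n.+1) (C : 'M[R]_(1, n.+1)) (lambda : 'I_n.+1 -> R)
    (lambda_inj : injective lambda)
    (lambda_eig : forall i : 'I_n.+1, eigenvalue A (lambda i))
    (AC_obs : observable A C) :
  (forall p : nat, (1 <= p)%N -> observable (tensor_sys A p) (tensor_out C p)) <->
  lin_indep_rat (fun i : 'I_n => lambda (lift ord0 i) - lambda ord0).
Proof.
have [P Punit AE] := distinct_eigenvalues_diag lambda_inj lambda_eig.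
move: AC_obs; rewrite {}AE; set d := \row_i lambda i.
move=> /(observable_conj_diag _ _ erefl Punit) [_ CP0].
rewrite -tensor_spec_inj -/d.
suff obsE p : observable (tensor_sys (invmx P *m diag_mx d *m P) p)
    (tensor_out C p) <-> injective (tensor_spec d p 0).
  by split=> H p p1; apply/obsE/H.
have [Qunit QV] := tensor_outV p Punit.
have dim1 : dimN 1 p = 1%N by rewrite /dimN add1n binn.
rewrite tensor_sys_diag // (observable_conj_diag _ _ dim1 Qunit).
rewrite -QV -tensor_outM; split=> [[]|specI] //; split=> // i j.
by apply: tensor_out_row_neq0 => l.
Qed.
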